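(* Let $\mathcal P_{\mathrm{do}}=\{P_{\mathrm{do}(i)}\}_{i\in V}$ be an interventional family whose members $P_{\mathrm{do}(i)}$ satisfy singleton-transitivity. Assume that for all distinct $i,j,k\in V$ such that $i\notin\mathrm{cause}(k)$ and $j\in\mathrm{cause}(k)$ we have: (a) $i\perp\!\!\!\perp_{P_{\mathrm{do}(i)}} k\mid j$; and (b) $j\not\perp\!\!\!\perp_{P_{\mathrm{do}(i)}} k$. Then $\mathcal P_{\mathrm{do}}$ is a transitive interventional family, i.e. for all distinct $i,j,k\in V$, if $i\in\mathrm{cause}(j)$ and $j\in\mathrm{cause}(k)$ then $i\in\mathrm{cause}(k)$.
   Context: $V$ is a finite set and an interventional family is a family $\mathcal P_{\mathrm{do}}=\{P_{\mathrm{do}(i)}\}_{i\in V}$ of probability distributions, all on the same product space $\mathcal X=\prod_{i\in V}\mathcal X_i$. For a probability measure $P$ on $\mathcal X$ and disjoint $A,B,C\subseteq V$, $A\perp\!\!\!\perp_P B\mid C$ means that for $P^C$-almost every $x_C$ the conditional measure $P^{A\cup B}(\cdot\mid x_C)$ is a product measure on $\mathcal X_A\times\mathcal X_B$ ($P^A$ denotes the marginal on $\mathcal X_A=\prod_{i\in A}\mathcal X_i$); $\not\perp\!\!\!\perp_P$ denotes its failure, and an empty conditioning set is omitted. Singletons $\{i\}$ are written $i$. $\mathrm{cause}(k)=\{i\in V:\ i\neq k,\ i\not\perp\!\!\!\perp_{P_{\mathrm{do}(i)}} k\}$. Singleton-transitivity of $P$: for distinct single elements $i,j,k$ and $C\subseteq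 V\setminus\{i,j,k\}$, if $i\perp\!\!\!\perp_P j\mid C$ and $i\perp\!\!\!\perp_P j\mid C\cup\{k\}$, then $i\perp\!\!\!\perp_P k\mid C$ or $j\perp\!\!\!\perp_P k\mid C$. *)

(* Defs.v *)
From HB Require Import structures.
From mathcomp Require Import all_boot all_order all_algebra.
From mathcomp Require Import all_classical all_reals all_analysis.

Set Implicit Arguments.
Unset Strict Implicit.
Unset Printing Implicit Defensive.

Local Open Scope classical_set_scope.
Local Open Scope ring_scope.
Local Open Scope ereal_scope.

Section product_space.
Context {I : Type} {d : I -> measure_display}.

Definition coord_cylinders (X : forall i, measurableType (d i)) :
    set (set (forall i, X i)) :=
  \bigcup_(i : I) preimage_set_system setT (fun x => x i) measurable.

Definition product_space (X : forall i, measurableType (d i)) : Type :=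
  forall i, X i.

HB.instance Definition _ (X : forall i, measurableType (d i)) :=
  Measurable.copy (product_space X) (g_sigma_algebraType (@coord_cylinders X)).

End product_space.

Section reindexing.
Context {I J : Type} {d : I -> measure_display}.
Variables (X : forall i, measurableType (d i)) (f : J -> I).

Definition reindex_prod (x : product_space X) :
  product_space (fun j => X (f j)) := fun j => x (f j).

Lemma measurable_reindex_prod : measurable_fun setT reindex_prod.
Proof.
apply: measurability => //= _ [_ [j _ [B mB <-]] <-].
rewrite !setTI; apply: sub_sigma_algebra.
by exists (f j) => //; exists B => //; rewrite setTI.
Qed.

HB.instance Definition _ :=
  isMeasurableFun.Build _ _ _ _ reindex_prod measurable_reindex_prod.

End reindexing.

Section conditional_independence.
Context {R : realType} {V : finType} {d : V -> measure_display}.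
Variable X : forall i, measurableType (d i).

(* [coord_space set0] has exactly one point. *)
Definition coord_space (A : set V) : Type :=
  product_space (fun i : A => X (set_val i)).

HB.instance Definition _ (A : set V) := Measurable.on (coord_space A).

Definition restr (A : set V) : {mfun product_space X >-> coord_space A} :=
  reindex_prod (fun i : A => set_val i).

Definition incl (A D : set V) (AD : A `<=` D) (i : A) : D :=
  exist _ (set_val i) (mem_set (AD _ (set_valP i))).

Definition subrestr (A D : set V) (AD : A `<=` D) (x : coord_space D) :
  coord_space A := fun i => x (incl AD i).

Definition marginal (P : probability (product_space X) R) (A : set V) :
  probability (coord_space A) R := distribution P (restr A).

Definition is_conditional_measure (P : probability (product_space X) R)
    (C D : set V) (kappa : R.-pker (coord_space C) ~> (coord_space D)) : Prop :=
  forall (E : set (coord_space C)) (F : set (coord_space D)),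
    measurable E -> measurable F ->
    \int[marginal P C]_(x in E) kappa x F =
    P ((restr C @^-1` E) `&` (restr D @^-1` F)).

(* For disjoint [A] and [B], [prod_split] is the canonical identification of the
   space indexed by [A `|` B] with the product of those indexed by [A] and
   [B]. *)
Definition prod_split (A B : set V) (x : coord_space (A `|` B)) :
    coord_space A * coord_space B :=
  (subrestr (@subsetUl _ A B) x, subrestr (@subsetUr _ A B) x).

Definition is_product_measure (A B : set V)
    (mu : {measure set (coord_space (A `|` B)) -> \bar R}) : Prop :=
  exists (muA : probability (coord_space A) R) (muB : probability (coord_space B) R),
    forall S : set (coord_space A * coord_space B), measurable S ->
      pushforward mu (@prod_split A B) S = (muA \x muB) S.

(* The coordinate spaces are arbitrary measurable spaces, so the conditional
   measure is asserted to exist, as a Markov kernel. On standard Borel spaces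
   it always exists and is unique up to a null set, so there the choice of
   [kappa] is immaterial. *)
Definition cond_indep (P : probability (product_space X) R) (A B C : set V) :
    Prop :=
  exists kappa : R.-pker (coord_space C) ~> (coord_space (A `|` B)),
    is_conditional_measure P kappa /\
    {ae marginal P C, forall x, is_product_measure (kappa x)}.

Definition indep (P : probability (product_space X) R) (A B : set V) : Prop :=
  cond_indep P A B set0.

Definition singleton_transitive (P : probability (product_space X) R) : Prop :=
  forall (i j k : V) (C : set V), i != j -> j != k -> i != k ->
    C `<=` ~` [set i; j; k] ->
    cond_indep P [set i] [set j] C ->
    cond_indep P [set i] [set j] (C `|` [set k]) ->
    cond_indep P [set i] [set k] C \/ cond_indep P [set j] [set k] C.

Definition cause (Pdo : V -> probability (product_space X) R) (k : V) : set V :=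
  [set i | i != k /\ ~ indep (Pdo i) [set i] [set k]].

Definition transitive_family (Pdo : V -> probability (product_space X) R) :
    Prop :=
  forall i j k : V, i != j -> j != k -> i != k ->
    cause Pdo j i -> cause Pdo k j -> cause Pdo k i.

End conditional_independence.

(* Main.v *)
Require Import Defs.
From mathcomp Require Import all_boot all_order all_algebra.
From mathcomp Require Import unstable.
From mathcomp Require Import all_classical all_reals all_analysis.

Local Open Scope classical_set_scope.

(** Suppose that [i] causes [j] and [j] causes [k], but [i] does not cause [k].
    Under the intervention on [i], the variables [i] and [k] are independent,
    because [i] is not a cause of [k], and they remain independent given [j],
    by hypothesis (a).  Singleton-transitivity with an empty conditioning set
    then makes [j] independent of [i] or of [k].  The first contradicts that [i]
    causes [j], the second contradicts hypothesis (b).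

    The second alternative is delivered as the independence of [k] and [j],
    whereas (b) denies that of [j] and [k], so the symmetry [cond_indepC] of
    conditional independence is required.  It rests on the symmetry of product
    measures, [product_measure_swap], which is an instance of Fubini. *)

Section symmetry.
Local Open Scope ring_scope.

(** Both sides are the iterated integral of the sections of [S], taken in the two
    possible orders. *)
Lemma product_measure_swap {d1 d2 : measure_display} {T1 : measurableType d1}
    {T2 : measurableType d2} {R : realType}
    (m1 : {sigma_finite_measure set T1 -> \bar R})
    (m2 : {sigma_finite_measure set T2 -> \bar R}) (S : set (T2 * T1)) :
  measurable S -> (m1 \x m2)%E (@swap T1 T2 @^-1` S) = (m2 \x m1)%E S.
Proof.
move=> mS.
have mS' : measurable (@swap T1 T2 @^-1` S).
  by rewrite -[X in measurable X]setTI; exact: measurable_swap.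
transitivity ((m1 \x^ m2)%E (@swap T1 T2 @^-1` S)).
  apply: product_measure_unique => // A B mA mB.
  exact: product_measure2E.
rewrite /product_measure2 /product_measure1 /=.
by apply: eq_integral => y _ /=; congr (m1 _).
Qed.

Context {R : realType} {V : finType} {d : V -> measure_display}.
Context {X : forall i : V, measurableType (d i)}.

(** The index sets [A `|` B] and [B `|` A] are equal but not convertible, so
    neither are the spaces that they index.  Splitting the coordinates of an
    arbitrary [D] that contains [A] and [B] lets one space serve for both. *)
Definition product_on {A B D : set V} (AD : A `<=` D) (BD : B `<=` D)
    (mu : {measure set (coord_space X D) -> \bar R}) : Prop :=
  exists (muA : probability (coord_space X A) R)
         (muB : probability (coord_space X B) R),
    forall S : set (coord_space X A * coord_space X B), measurable S ->
      pushforward mu (fun x => (subrestr AD x, subrestr BD x)) S =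
      (muA \x muB)%E S.

Lemma product_onC {A B D : set V} (AD : A `<=` D) (BD : B `<=` D)
    (mu : {measure set (coord_space X D) -> \bar R}) :
  product_on AD BD mu -> product_on BD AD mu.
Proof.
move=> [muA [muB mu_prod]]; exists muB, muA => S mS.
rewrite -product_measure_swap// -mu_prod//.
by rewrite -[X in measurable X]setTI; exact: measurable_swap.
Qed.

Definition cond_indep_on (P : probability (product_space X) R)
    {A B : set V} (C : set V) {D : set V} (AD : A `<=` D) (BD : B `<=` D) : Prop :=
  exists kappa : R.-pker (coord_space X C) ~> (coord_space X D),
    is_conditional_measure P kappa /\
    {ae marginal P C, forall x, product_on AD BD (kappa x)}.

Lemma cond_indep_onC (P : probability (product_space X) R)
    {A B : set V} (C : set V) {D : set V} (AD : A `<=` D) (BD : B `<=` D) :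
  cond_indep_on P C AD BD -> cond_indep_on P C BD AD.
Proof.
move=> [kappa [kappa_cond kappa_prod]]; exists kappa; split => //.
by apply: filterS kappa_prod => x; exact: product_onC.
Qed.

Lemma cond_indepC (P : probability (product_space X) R) (A B C : set V) :
  cond_indep P A B C -> cond_indep P B A C.
Proof.
(* [cond_indep] is [cond_indep_on] at [D := A `|` B]; generalizing [D] there turns
   [setUC] into a change of index set. *)
move=> /(cond_indep_onC P C (@subsetUl _ A B) (@subsetUr _ A B)).
suff transport D (BD : B `<=` D) (AD : A `<=` D) : D = B `|` A ->
    cond_indep_on P C BD AD -> cond_indep P B A C.
  by apply: transport; exact: setUC.
move=> DE; subst D.
by rewrite (Prop_irrelevance BD (@subsetUl _ B A))
           (Prop_irrelevance AD (@subsetUr _ B A)).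
Qed.

End symmetry.

Theorem theorem10 (R : realType) (V : finType) (d : V -> measure_display)
    (X : forall i : V, measurableType (d i))
    (Pdo : V -> probability (product_space X) R)
    (Hst : forall i : V, singleton_transitive (Pdo i))
    (Hab : forall i j k : V, i != j -> j != k -> i != k ->
      ~ cause Pdo k i -> cause Pdo k j ->
      cond_indep (Pdo i) [set i] [set k] [set j] /\
      ~ indep (Pdo i) [set j] [set k]) :
  transitive_family Pdo.
Proof.
move=> i j k ij jk ik [_ i_dep_j] j_cause_k.
apply: contrapT => i_ncause_k.
have [ik_given_j j_dep_k] := Hab i j k ij jk ik i_ncause_k j_cause_k.
have ik_indep : indep (Pdo i) [set i] [set k].
  by apply: contrapT => i_dep_k; apply: i_ncause_k; split.
have kj : k != j by rewrite eq_sym.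
have ik_given_0j : cond_indep (Pdo i) [set i] [set k] (set0 `|` [set j]).
  by rewrite set0U.
have [//|kj_indep] := Hst i i k j set0 ik kj ij (@sub0set _ _) ik_indep ik_given_0j.
by apply: j_dep_k; exact: cond_indepC.
Qed.
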